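(* Let $(P,\leq,\cdot,P^\#)$ be a partial combinatory algebra. Let $DP$ be the collection of downwards closed subsets of $P$, ordered by inclusion, and for $X,Y\in DP$ put $$X\to Y:=\{z\in P : \text{for all } x\in X,\ zx \text{ is defined and } zx\in Y\}.$$ Then $(DP,\subseteq,\to)$ is an arrow structure, and $S:=\{X\in DP : X\cap P^\#\neq\emptyset\}$ is a separator on it, so that $(DP,\subseteq,\to,S)$ is an arrow algebra. Moreover, this arrow algebra is compatible with joins.
   Context: A partial applicative poset is a triple $(P,\cdot,\leq)$ with $(P,\leq)$ a poset and $\cdot$ a partial binary operation on $P$ (application, written $ab$, associating to the left) such that if $a'b'$ is defined and $a\leq a'$, $b\leq b'$, then $ab$ is defined and $ab\leq a'b'$. A filter is a subset $P^\#\subseteq P$ such that (i) if $a,b\in P^\#$ and $ab$ is defined then $ab\in P^\#$; (ii) if $a\leq b$ and $a\in P^\#$ then $b\in P^\#$. A quadruple $(P,\leq,\cdot,P^\#)$ with $P^\#$ a filter is a partial combinatory algebra (pca) if there are $k,s\in P^\#$ such that for all $a,b,c\in P$: $kab$ is defined and $kab\leq a$; $sab$ is defined; if $ac(bc)$ is defined then so is $sabc$, and $sabc\leq ac(bc)$. An arrow structure is a complete poset $(A,\preccurlyeq)$ (infima $\bigwedge$, suprema $\bigvee$) with a binary operation $\to$ such that $a'\preccurlyeq a$ and $b\preccurlyeq b'$ imply $a\to b\preccurlyeq a'\to b'$. The operation $\to$ associates to the right and binds stronger than $\bigwedge$. A separator on it is a subset $S\subseteq A$ such that: (1) $a\in S$,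 $a\preccurlyeq b$ imply $b\in S$; (2) $a\to b\in S$ and $a\in S$ imply $b\in S$; (3) $S$ contains $$\mathbf k=\bigwedge_{a,b\in A}a\to b\to a,\qquad \mathbf s=\bigwedge_{a,b,c\in A}(a\to b\to c)\to(a\to b)\to(a\to c),$$ $$\mathbf a=\bigwedge_{x,I,(y_i)_{i\in I},(z_i)_{i\in I}}\Big(\bigwedge_{i\in I}x\to y_i\to z_i\Big)\to x\to\Big(\bigwedge_{i\in I}y_i\to z_i\Big),$$ where in $\mathbf a$ the infimum is over all $x\in A$, all sets $I$ and all $I$-indexed families in $A$ (equivalently, $\mathbf a=\bigwedge_{a\in A,\,B\subseteq \mathrm{Im}(\to)}(\bigwedge_{b\in B}a\to b)\to a\to\bigwedge_{b\in B}b$). An arrow algebra is an arrow structure together with a separator on it. It is compatible with joins if $(\bigvee_{b\in B}b)\to a=\bigwedge_{b\in B}(b\to a)$ for all $a\in A$ and $B\subseteq A$. *)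

(* Defs.v *)
From HB Require Import structures.
From mathcomp Require Import all_boot all_order.
From mathcomp Require Import boolp classical_sets.

Set Implicit Arguments.
Unset Strict Implicit.
Unset Printing Implicit Defensive.

Import Order.TTheory.
Local Open Scope classical_set_scope.
Local Open Scope order_scope.

(* [app a b = None] means that the application ab is undefined. *)
Record partialApplicativePoset (d : Order.disp_t) := PartialApplicativePoset {
  pap_sort :> porderType d;
  app : pap_sort -> pap_sort -> option pap_sort;
  app_le : forall a a' b b' c' : pap_sort,
    a <= a' -> b <= b' -> app a' b' = Some c' ->
    exists2 c, app a b = Some c & c <= c' }.

(* Application of possibly undefined terms: undefined as soon as one of the
   two arguments is. *)
Definition tapp (d : Order.disp_t) (P : partialApplicativePoset d)
    (t u : option P) : option P :=
  obind (fun a => obind (fun b => app a b) u) t.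

Notation "t • u" := (tapp t u) (at level 40, left associativity).

Record is_filter (d : Order.disp_t) (P : partialApplicativePoset d)
    (F : set P) : Prop := {
  filter_app : forall a b c : P, F a -> F b -> app a b = Some c -> F c;
  filter_up : forall a b : P, a <= b -> F a -> F b }.

Definition k_axiom (d : Order.disp_t) (P : partialApplicativePoset d)
    (k : P) : Prop :=
  forall a b : P, exists2 r, Some k • Some a • Some b = Some r & r <= a.

Definition s_axiom (d : Order.disp_t) (P : partialApplicativePoset d)
    (s : P) : Prop :=
  forall a b c : P,
    (exists r, Some s • Some a • Some b = Some r) /\
    (forall v, (Some a • Some c) • (Some b • Some c) = Some v ->
      exists2 r, Some s • Some a • Some b • Some c = Some r & r <= v).

Record is_pca (d : Order.disp_t) (P : partialApplicativePoset d)
    (F : set P) : Prop := {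
  pca_filter : is_filter F;
  pca_ks : exists k s : P, [/\ F k, F s, k_axiom k & s_axiom s] }.

(* The completeness of the poset [A] is part of the axioms. *)
Record is_arrow_structure (d : Order.disp_t) (A : porderType d)
    (arr : A -> A -> A) : Prop := {
  inf_exists : forall B : set A, infimums B !=set0;
  sup_exists : forall B : set A, supremums B !=set0;
  arr_le : forall a a' b b' : A, a' <= a -> b <= b' -> arr a b <= arr a' b' }.

Section ArrowStructure.
Context (d : Order.disp_t) (A : porderType d) (arr : A -> A -> A).
Hypothesis hA : is_arrow_structure arr.

(* Not [infimum] and [supremum] of classical_sets, which return a default
   value on the empty set. *)
Definition bigmeet (B : set A) : A := sval (cid (inf_exists hA B)).
Definition bigjoin (B : set A) : A := sval (cid (sup_exists hA B)).

Local Notation "a ~> b" := (arr a b) (at level 45, right associativity).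

Definition arrow_k : A :=
  bigmeet [set w | exists a b : A, w = a ~> b ~> a].

Definition arrow_s : A :=
  bigmeet [set w | exists a b c : A,
    w = (a ~> b ~> c) ~> (a ~> b) ~> (a ~> c)].

Definition arrow_a : A :=
  bigmeet [set w | exists (x : A) (I : Type) (y z : I -> A),
    w = bigmeet (range (fun i => x ~> y i ~> z i)) ~>
        x ~> bigmeet (range (fun i => y i ~> z i))].

Record is_separator (S : set A) : Prop := {
  separator_up : forall a b : A, S a -> a <= b -> S b;
  separator_mp : forall a b : A, S (a ~> b) -> S a -> S b;
  separator_k : S arrow_k;
  separator_s : S arrow_s;
  separator_a : S arrow_a }.

Definition compatible_with_joins : Prop :=
  forall (a : A) (B : set A),
    bigjoin B ~> a = bigmeet [set b ~> a | b in B].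

End ArrowStructure.

Definition down_closed (d : Order.disp_t) (P : porderType d)
    (X : set P) : Prop :=
  forall x y : P, y <= x -> X x -> X y.

Record downset (d : Order.disp_t) (P : porderType d) := Downset {
  downset_set :> set P;
  downsetP : `[< down_closed downset_set >] }.

HB.instance Definition _ (d : Order.disp_t) (P : porderType d) :=
  [isSub for @downset_set d P].
HB.instance Definition _ (d : Order.disp_t) (P : porderType d) :=
  [Choice of downset P by <:].
(* The order induced by that of [set P], which is inclusion. *)
HB.instance Definition _ (d : Order.disp_t) (P : porderType d) :=
  [SubChoice_isSubPOrder of downset P by <: with set_display].

Lemma downset_leE (d : Order.disp_t) (P : porderType d) (X Y : downset P) :
  (X <= Y) = (X `<=` Y)%classic :> Prop.
Proof. by rewrite -subsetEset. Qed.

Section DownsetArrow.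
Context (d : Order.disp_t) (P : partialApplicativePoset d).

Definition downset_arr_set (X Y : downset P) : set P :=
  [set z | forall x, (X : set P) x ->
    exists2 r, app z x = Some r & (Y : set P) r].

Lemma downset_arr_closed (X Y : downset P) :
  `[< down_closed (downset_arr_set X Y) >].
Proof.
apply/asboolP => z z' lez hz x Xx; have [r zxr Yr] := hz x Xx.
have [r' z'xr' ler] := app_le lez (lexx x) zxr.
by exists r' => //; have /asboolP Ydown := downsetP Y; apply: Ydown ler Yr.
Qed.

Definition downset_arr (X Y : downset P) : downset P :=
  Downset (downset_arr_closed X Y).

Definition downset_sep (F : set P) : set (downset P) :=
  [set X : downset P | (X : set P) `&` F !=set0].

End DownsetArrow.

(* Main.v *)
Require Import Defs.
From mathcomp Require Import all_boot all_order.
From mathcomp Require Import boolp classical_sets.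

(** Downward closed sets are stable under arbitrary intersections and unions,
so these are the infima and suprema of [downset P], and an element of
[downset_arr X Y] is a realizer: an element of [P] which sends every element
of [X] to an element of [Y]. Compatibility with joins is then immediate, since
sending the elements of a union into [Y] means doing so for each member of the
union.

Modus ponens for the separator is closure of the filter under application. The
three distinguished elements of the separator are infima, hence intersections,
and to put them in the separator one needs a single element of the filter which
realizes all the arrows in question at once. The combinators [k] and [s] of the
pca do this for the first two: what they are required to compute does not
mention the downsets. For the third, if [w] realizes every
[X -> Y_i -> Z_i], then [x] in [X] must be sent to a common realizer of all the
[Y_i -> Z_i]. When the index set is nonempty, [w x] is one, but when it is empty
[w] and [x] are arbitrary and [w x] may be undefined, whereas a value is still
required. So the realizer is taken to be an eta-expanded identity
[e = fun w x y => w x y], whose value [e w x] always exists although [w x] need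
not. It is obtained from combinatory completeness ([eval_abs], [eta_realizer]):
the abstraction of a term always denotes an element, whether or not the term
does. *)

Set Implicit Arguments.
Unset Strict Implicit.
Unset Printing Implicit Defensive.

Import Order.TTheory.
Local Open Scope classical_set_scope.
Local Open Scope order_scope.

(** * Terms and combinatory completeness *)

Section PartialTerms.
Context (d : Order.disp_t) (P : partialApplicativePoset d).

(** The comparison of possibly undefined elements used by [s_axiom]: anything
lies below an undefined element. *)
Definition ole (u v : option P) : Prop :=
  forall b, v = Some b -> exists2 a, u = Some a & a <= b.

Lemma ole_refl u : ole u u.
Proof. by move=> a ->; exists a. Qed.

Lemma ole_trans v u w : ole u v -> ole v w -> ole u w.
Proof.
move=> uv vw c /vw[b /uv[a -> leab] lebc].
by exists a => //; exact: le_trans lebc.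
Qed.

Lemma ole_tapp u u' v v' : ole u u' -> ole v v' -> ole (u • v) (u' • v').
Proof.
case: u' v' => [a'|] [b'|] //= uu' vv' c' /=.
have [a -> leaa'] := uu' _ erefl; have [b -> lebb'] := vv' _ erefl.
exact: app_le.
Qed.

Lemma tapp_Some (u v : option P) (c : P) : u • v = Some c ->
  exists a b : P, [/\ u = Some a, v = Some b & app a b = Some c].
Proof. by case: u v => [a|] [b|] //= abc; exists a, b. Qed.

End PartialTerms.

(** Combinatory terms with de Bruijn variables. The combinators are the only
constants, so that a term evaluates into any filter containing them. *)
Inductive term := K | S | Var of nat | App of term & term.

(** Bracket abstraction of the variable [0]; the other variables are shifted
down. *)
Fixpoint abs (t : term) : term :=
  match t with
  | Var 0 => App (App S K) K
  | Var n.+1 => App K (Var n)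
  | App t u => App (App S (abs t)) (abs u)
  | c => App K c
  end.

Section CombinatoryCompleteness.
Context (d : Order.disp_t) (P : partialApplicativePoset d) (k s : P).
Hypotheses (kP : k_axiom k) (sP : s_axiom s).
#[local] Arguments tapp : simpl never.

(** Variables beyond the environment are read as [k], so that a variable always
has a value, and one in the filter when the environment is empty. *)
Fixpoint eval (env : seq P) (t : term) : option P :=
  match t with
  | K => Some k
  | S => Some s
  | Var n => Some (nth k env n)
  | App t u => eval env t • eval env u
  end.

Lemma k_defined a : exists r, Some k • Some a = Some r.
Proof. by have [r /tapp_Some[q [_ [-> _ _]]] _] := kP a a; exists q. Qed.

Lemma s_defined a : exists r, Some s • Some a = Some r.
Proof. by have [[r /tapp_Some[q [_ [-> _ _]]]] _] := sP a a a; exists q. Qed.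

Lemma s_defined2 a b : exists r, Some s • Some a • Some b = Some r.
Proof. by have [] := sP a b a. Qed.

Lemma ole_k a b : ole (Some k • Some a • Some b) (Some a).
Proof. by move=> _ [<-]; exact: kP. Qed.

Lemma ole_s a b c :
  ole (Some s • Some a • Some b • Some c)
      ((Some a • Some c) • (Some b • Some c)).
Proof. by have [_] := sP a b c. Qed.

(** The abstraction of an application starts with [s], which is defined on any
two arguments, so nothing is asked of the application itself. *)
Lemma abs_defined env t : exists r, eval env (abs t) = Some r.
Proof.
elim: t => [||[|n]|t [a ta] u [b ub]] /=; try exact: k_defined.
- exact: s_defined2.
- by rewrite ta ub; exact: s_defined2.
Qed.

(** Only an inequality holds, because [k] and [s] satisfy their laws only up to
[<=]; monotonicity of application carries it through the application case,
where [s] hands [x] to both subterms. *)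
Lemma eval_abs env t x : ole (eval env (abs t) • Some x) (eval (x :: env) t).
Proof.
elim: t => [||[|n]|t IHt u IHu] /=; try exact: ole_k.
- (* [s k k x] lies below [k x (k x)], hence below [x] *)
  apply: ole_trans; first exact: ole_s.
  by have [r kxr] := k_defined x; rewrite {2}kxr; exact: ole_k.
- move: IHt IHu.
  have [a ->] := abs_defined env t; have [b ->] := abs_defined env u.
  by move=> IHt IHu; apply: ole_trans (ole_tapp IHt IHu); exact: ole_s.
Qed.

Lemma eval_filter (F : set P) t r :
  is_filter F -> F k -> F s -> eval [::] t = Some r -> F r.
Proof.
move=> hF Fk Fs; elim: t r => [||n|t IHt u IHu] r /=.
- by case=> <-.
- by case=> <-.
- by rewrite nth_nil => -[<-].
- by case/tapp_Some=> a [b [/IHt Fa /IHu Fb]]; exact: filter_app hF _ _ _ Fa Fb.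
Qed.

End CombinatoryCompleteness.

(** The term [fun w x y => w x y]: the middle conjunct would fail for the
identity combinator, as [w x] may be undefined. *)
Lemma eta_realizer (d : Order.disp_t) (P : partialApplicativePoset d)
    (F : set P) : is_pca F ->
  exists e, [/\ F e,
    forall w x, exists r, Some e • Some w • Some x = Some r &
    forall w x y,
      ole (Some e • Some w • Some x • Some y) (Some w • Some x • Some y)].
Proof.
case=> hF [k [s [Fk Fs kP sP]]].
pose t := App (App (Var 2) (Var 1)) (Var 0).
have [e evale] := abs_defined kP sP [::] (abs (abs t)).
have e2 w x : ole (Some e • Some w • Some x) (eval k s [:: x; w] (abs t)).
  apply: ole_trans; last exact: eval_abs.
  apply: ole_tapp; last exact: ole_refl.
  by rewrite -evale; exact: eval_abs.
exists e; split.
- exact: eval_filter hF Fk Fs evale.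
- move=> w x; have [r /e2[q eq _]] := abs_defined kP sP [:: x; w] t.
  by exists q.
- move=> w x y.
  have ety : ole (eval k s [:: x; w] (abs t) • Some y)
                 (Some w • Some x • Some y) by exact: (eval_abs _ _ (t := t)).
  apply: ole_trans ety; apply: ole_tapp; [exact: e2|exact: ole_refl].
Qed.

(** * The complete lattice of downsets *)

Section DownsetLattice.
Context (d : Order.disp_t) (P : porderType d).

Lemma downset_down (X : downset P) (x y : P) :
  y <= x -> (X : set P) x -> (X : set P) y.
Proof. by have /asboolP := downsetP X; apply. Qed.

Lemma downset_ext (X Y : downset P) :
  (forall p, (X : set P) p <-> (Y : set P) p) -> X = Y.
Proof.
move=> XY; apply/le_anti/andP.
by split; rewrite downset_leE => p /XY.
Qed.

Lemma downset_meet_closed (B : set (downset P)) :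
  `[< down_closed [set p | forall X : downset P, B X -> (X : set P) p] >].
Proof.
by apply/asboolP => x y leyx Bx X BX; exact: downset_down leyx (Bx X BX).
Qed.

Definition downset_meet (B : set (downset P)) : downset P :=
  Downset (downset_meet_closed B).

Lemma downset_join_closed (B : set (downset P)) :
  `[< down_closed [set p | exists2 X : downset P, B X & (X : set P) p] >].
Proof.
apply/asboolP => x y leyx [X BX Xx].
by exists X => //; exact: downset_down leyx Xx.
Qed.

Definition downset_join (B : set (downset P)) : downset P :=
  Downset (downset_join_closed B).

Lemma downset_meetP B : infimums B (downset_meet B).
Proof.
split=> [X BX|X lbX]; rewrite downset_leE => p; first exact.
by move=> Xp Y /lbX; rewrite downset_leE; exact.
Qed.

Lemma downset_joinP B : supremums B (downset_join B).
Proof.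
split=> [X BX|X ubX]; rewrite downset_leE => p; first by exists X.
by case=> Y /ubX; rewrite downset_leE => YX /YX.
Qed.

Context (arr : downset P -> downset P -> downset P).
Hypothesis hA : is_arrow_structure arr.

Lemma bigmeet_downset B : bigmeet hA B = downset_meet B.
Proof.
rewrite /bigmeet; case: cid => X /= [lbX gX].
have [lbM gM] := downset_meetP B.
by apply/le_anti; rewrite gM ?gX.
Qed.

Lemma bigjoin_downset B : bigjoin hA B = downset_join B.
Proof.
rewrite /bigjoin; case: cid => X /= [ubX lX].
have [ubJ lJ] := downset_joinP B.
by apply/le_anti; rewrite lX ?lJ.
Qed.

End DownsetLattice.

(** * The arrow algebra of downsets *)

Section DownsetArrowAlgebra.
Context (d : Order.disp_t) (P : partialApplicativePoset d).

Lemma downset_arrow_structure : is_arrow_structure (@downset_arr d P).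
Proof.
split=> [B|B|X X' Y Y'].
- by exists (downset_meet B); exact: downset_meetP.
- by exists (downset_join B); exact: downset_joinP.
- rewrite !downset_leE => X'X YY' z hz x /X'X/hz[r zxr /YY' Y'r].
  by exists r.
Qed.

Context (hA : is_arrow_structure (@downset_arr d P)).

Lemma downset_compatible_with_joins : compatible_with_joins hA.
Proof.
move=> Y B; rewrite bigjoin_downset bigmeet_downset.
apply: downset_ext => z; split=> [hz _ [X BX <-] x Xx|hz x [X BX Xx]].
- by apply: hz; exists X.
- by apply: (hz (downset_arr X Y)) => //; exists X.
Qed.

Context (F : set P) (hP : is_pca F).

Lemma downset_sep_mp (X Y : downset P) :
  downset_sep F (downset_arr X Y) -> downset_sep F X -> downset_sep F Y.
Proof.
move=> [z [hz Fz]] [x [/hz[r zxr Yr] Fx]].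
by exists r; split=> //; exact: filter_app (pca_filter hP) _ _ _ Fz Fx zxr.
Qed.

Lemma downset_sep_k : downset_sep F (arrow_k hA).
Proof.
have [_ [k [s [Fk _ kP _]]]] := hP.
exists k; split=> //; rewrite /arrow_k bigmeet_downset => _ [X [Y ->]] a Xa.
have [r kar] := k_defined kP a; exists r => // b Yb.
have := kP a b; rewrite kar => -[q rbq leqa].
by exists q => //; exact: downset_down leqa Xa.
Qed.

Lemma downset_sep_s : downset_sep F (arrow_s hA).
Proof.
have [_ [k [s [_ Fs _ sP]]]] := hP.
exists s; split=> //; rewrite /arrow_s bigmeet_downset => _ [X [Y [Z ->]]] a ha.
have [sa sar] := s_defined sP a; exists sa => // b hb.
have := s_defined2 sP a b; rewrite sar => -[sab sabr]; exists sab => // c Xc.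
have [ac acr hac] := ha c Xc; have [bc bcr Ybc] := hb c Xc.
have [v vr Zv] := hac bc Ybc.
have [|r] := @ole_s _ _ _ sP a b c v.
  by rewrite /= acr bcr.
rewrite sar sabr => rE lerv.
by exists r => //; exact: downset_down lerv Zv.
Qed.

Lemma downset_sep_a : downset_sep F (arrow_a hA).
Proof.
have [e [Fe edef eP]] := eta_realizer hP.
exists e; split=> //.
rewrite /arrow_a bigmeet_downset => _ [X [I [Y [Z ->]]]] w.
rewrite !bigmeet_downset => hw.
have [q ewq] : exists q, Some e • Some w = Some q.
  by have [r /tapp_Some[q [_ [-> _ _]]]] := edef w w; exists q.
exists q => // x Xx.
(* [e w x] has to be exhibited before an index is available *)
have := edef w x; rewrite ewq => -[r qxr]; exists r => // _ [i _ <-] y Yy.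
have [|wx wxr hwx] := hw (downset_arr X (downset_arr (Y i) (Z i))) _ x Xx.
  by exists i.
have [v vr Zv] := hwx y Yy.
have [|u] := eP w x y v; first by rewrite /= wxr.
rewrite ewq qxr => uE leuv.
by exists u => //; exact: downset_down leuv Zv.
Qed.

Lemma downset_separator : is_separator hA (downset_sep F).
Proof.
split.
- move=> X Y [x [Xx Fx]]; rewrite downset_leE => XY.
  by exists x; split=> //; exact: XY.
- exact: downset_sep_mp.
- exact: downset_sep_k.
- exact: downset_sep_s.
- exact: downset_sep_a.
Qed.

End DownsetArrowAlgebra.

Theorem theorem3p9 (d : Order.disp_t) (P : partialApplicativePoset d)
    (F : set P) (hP : is_pca F) :
  exists hA : is_arrow_structure (@downset_arr d P),
    is_separator hA (downset_sep F) /\ compatible_with_joins hA.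
Proof.
exists (downset_arrow_structure P); split.
- exact: downset_separator.
- exact: downset_compatible_with_joins.
Qed.
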